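(* Let $V$ be the $\mathbb{C}$-vector space with basis $d_1,\dots,d_n$, and let $\zeta_{i,k,l}\in\mathbb{C}$ and $\xi_{i,k,l}(t)\in\mathbb{C}[t]$ ($1\le i,k,l\le n$) be such that $$q_kq_l-\sum_{i=1}^n\bigl(\zeta_{i,k,l}\,q_i+t\,\xi_{i,k,l}(t)\,q_i\bigr)\in I\qquad\text{for all }k,l\in\{1,\dots,n\}.$$ Then the multiplication rule $$d_k\ast_t d_l=\sum_{i=1}^n\bigl(\zeta_{i,k,l}\,d_i+t\,\xi_{i,k,l}(t)\,d_i\bigr)$$ gives a formal deformation (i.e. its $\mathbb{C}[t]$-bilinear extension to $V[t]$ is associative, so that it is a formal deformation of the algebra $(V,\ast_0)$) such that $\ast_1$, obtained by setting $t=1$, gives the multiplication on an algebra generated by $d_1,\dots,d_n$ which is isomorphic to $\mathbb{C}[x,y][t]/\langle I,t-1\rangle$.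
   Context: Let $A$ be an associative unital finite-dimensional $\mathbb{C}$-algebra and $n=\dim_{\mathbb{C}}A$. $\mathbb{C}[x,y]$ denotes the free associative unital $\mathbb{C}$-algebra in non-commuting variables $x,y$, and $\mathbb{C}[x,y][t]$ the polynomial ring over it in a central variable $t$. Let $m\ge1$ and $a_1,\dots,a_m,b_1,\dots,b_m\in A$ be such that $\sum_{i=1}^m a_i$ and $\sum_{i=1}^m b_i$ generate $A$ as a $\mathbb{C}$-algebra. Let $f:\mathbb{C}[x,y][t]\to A[t]$ be the homomorphism of $\mathbb{C}$-algebras with $f(x)=\sum_{i=1}^m a_it^i$, $f(y)=\sum_{i=1}^m b_it^i$, $f(t)=t$, and let $I=\ker f$. Standing assumption: for every $r\in A$ there is $i=i(r)\in\mathbb{N}$ with $rt^i\in\operatorname{im}f$. Let $p_1<p_2<\cdots$ be the monomials of $\mathbb{C}[x,y]$ in shortlex order with $1<x<y$. Let $q_1,\dots,q_n\in\mathbb{C}[x,y][t]$ be elements such that $f(p_k)\in\sum_{i=1}^n\mathbb{C}[t]f(q_i)$ for every $k$ (such elements exist). $\langle I,t-1\rangle$ is the two-sided ideal of $\mathbb{C}[x,y][t]$ generated by $I$ and $t-1$. A formal deformation of a $\mathbb{C}$-algebra $B$ is an associative $\mathbb{C}[t]$-bilinear multiplication on $B[t]$ which at $t=0$ specializes to the multiplication of $B$. *)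

(* Defs.v *)
From HB Require Import structures.
From mathcomp Require Import all_boot all_algebra.
From mathcomp Require Import boolp monalg.

Set Implicit Arguments.
Unset Strict Implicit.
Unset Printing Implicit Defensive.

Import GRing.Theory.

Local Open Scope ring_scope.
Local Open Scope quotient_scope.

(* Quotient of a not necessarily commutative ring by the two-sided ideal       *)
(* generated by a subset.  [ring_quotient] only covers commutative rings; its  *)
(* additive quotient [Quotient.quot] is reused here.  The quotient may be the  *)
(* zero ring, hence only a [pzRingType].                                       *)

Inductive ideal_gen (R : pzRingType) (S : R -> Prop) : R -> Prop :=
| ideal_gen_base x : S x -> ideal_gen S x
| ideal_gen_0 : ideal_gen S 0
| ideal_gen_B x y : ideal_gen S x -> ideal_gen S y -> ideal_gen S (x - y)
| ideal_gen_Ml a x : ideal_gen S x -> ideal_gen S (a * x)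
| ideal_gen_Mr a x : ideal_gen S x -> ideal_gen S (x * a).

Section QuotientByGeneratedIdeal.
Variables (R : nzRingType) (S : R -> Prop).

Definition ideal_pred : {pred R} := [pred x | `[< ideal_gen S x >]].

Lemma ideal_predP x : reflect (ideal_gen S x) (x \in ideal_pred).
Proof. exact: asboolP. Qed.

Fact ideal_pred_zmod : zmod_closed ideal_pred.
Proof.
split=> [|x y /ideal_predP Sx /ideal_predP Sy]; apply/ideal_predP.
  exact: ideal_gen_0.
exact: ideal_gen_B.
Qed.

HB.instance Definition _ := GRing.isZmodClosed.Build R ideal_pred
  ideal_pred_zmod.

Definition quot_by : Type := Quotient.quot ideal_pred.

HB.instance Definition _ := GRing.Zmodule.on quot_by.
HB.instance Definition _ :=
  EqQuotient.copy quot_by (Quotient.quot ideal_pred).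

Definition quot_proj (x : R) : quot_by := \pi_quot_by x.

Lemma quot_projP x y : quot_proj x = quot_proj y <-> ideal_gen S (x - y).
Proof.
rewrite /quot_proj; split=> [/eqP|/ideal_predP Sxy].
  by rewrite -Quotient.idealrBE => /ideal_predP.
by apply/eqP; rewrite -Quotient.idealrBE.
Qed.

Lemma quot_proj_repr (u : quot_by) : quot_proj (repr u) = u.
Proof. exact: reprK. Qed.

Lemma quot_projD : {morph quot_proj : x y / x + y}.
Proof. exact: Quotient.pi_add. Qed.

Lemma quot_projN : {morph quot_proj : x / - x}.
Proof. exact: Quotient.pi_opp. Qed.

Definition quot_one : quot_by := quot_proj 1.
Definition quot_mul (u v : quot_by) : quot_by := quot_proj (repr u * repr v).

Lemma quot_projM : {morph quot_proj : x y / x * y >-> quot_mul x y}.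
Proof.
move=> x y; apply/quot_projP.
set x' := repr _; set y' := repr _.
have -> : x * y - x' * y' = (x - x') * y - x' * (y' - y).
  by rewrite mulrBl mulrBr opprB addrA subrK.
apply: ideal_gen_B; first apply: ideal_gen_Mr; last apply: ideal_gen_Ml.
  by apply/quot_projP; rewrite quot_proj_repr.
by apply/quot_projP; rewrite quot_proj_repr.
Qed.

Fact quot_mulA : associative quot_mul.
Proof.
move=> u v w; rewrite -[u]quot_proj_repr -[v]quot_proj_repr -[w]quot_proj_repr.
by rewrite -!quot_projM mulrA.
Qed.

Fact quot_mul1 : left_id quot_one quot_mul.
Proof. by move=> u; rewrite -[u]quot_proj_repr -quot_projM mul1r. Qed.

Fact quot_mulr1 : right_id quot_one quot_mul.
Proof. by move=> u; rewrite -[u]quot_proj_repr -quot_projM mulr1. Qed.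

Fact quot_mulDl : left_distributive quot_mul +%R.
Proof.
move=> u v w; rewrite -[u]quot_proj_repr -[v]quot_proj_repr -[w]quot_proj_repr.
by rewrite -quot_projD -!quot_projM -quot_projD mulrDl.
Qed.

Fact quot_mulDr : right_distributive quot_mul +%R.
Proof.
move=> u v w; rewrite -[u]quot_proj_repr -[v]quot_proj_repr -[w]quot_proj_repr.
by rewrite -quot_projD -!quot_projM -quot_projD mulrDr.
Qed.

HB.instance Definition _ := GRing.Zmodule_isPzRing.Build quot_by
  quot_mulA quot_mul1 quot_mulr1 quot_mulDl quot_mulDr.

Fact quot_proj_zmod : zmod_morphism quot_proj.
Proof. by move=> x y; rewrite quot_projD quot_projN. Qed.

Fact quot_proj_monoid : monoid_morphism quot_proj.
Proof. by split=> // x y; rewrite quot_projM. Qed.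

HB.instance Definition _ := GRing.isZmodMorphism.Build R quot_by quot_proj
  quot_proj_zmod.
HB.instance Definition _ := GRing.isMonoidMorphism.Build R quot_by quot_proj
  quot_proj_monoid.

End QuotientByGeneratedIdeal.

(* [ncpoly F] is F<x,y>, the monoid algebra of the free monoid on two letters; *)
(* the variable t of [{poly ncpoly F}] is central.                             *)

Definition ncpoly (F : comNzRingType) : lalgType F :=
  {malg F[{fmonom bool}]}.

Definition ncmon (F : comNzRingType) (w : {fmonom bool}) : ncpoly F :=
  mkmalgU w (1 : F).

Definition ncx (F : comNzRingType) : ncpoly F := ncmon F (fmu false).
Definition ncy (F : comNzRingType) : ncpoly F := ncmon F (fmu true).

(* [{poly L}] is canonically a module over [L] only; [scal_t] and [poly_t] are *)
(* the structure maps from F and F[t].                                         *)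

Definition scal_t (F : comNzRingType) (L : lalgType F) (c : F) : {poly L} :=
  (c%:A)%:P.

Definition poly_t (F : comNzRingType) (L : lalgType F) (c : {poly F}) :
  {poly L} := map_poly (in_alg L) c.

(* Multiplications on the free module with basis [basis_vec i], i < n.  For    *)
(* V := 'rV[F]_n, the module V[t] is represented by 'rV[{poly F}]_n.           *)

Definition basis_vec (S : comNzRingType) (n : nat) (i : 'I_n) : 'rV[S]_n :=
  delta_mx 0 i.

Definition bilinear_ext (S : comNzRingType) (n : nat)
    (g : 'I_n -> 'I_n -> 'rV[S]_n) (u v : 'rV[S]_n) : 'rV[S]_n :=
  \sum_(k < n) \sum_(l < n) (u 0 k * v 0 l) *: g k l.

Definition bilinear_mul (S : comNzRingType) (V : lmodType S)
    (mul : V -> V -> V) : Prop :=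
  (forall u, linear (mul u)) /\ (forall v, linear (mul^~ v)).

Definition algebra_mul (S : comNzRingType) (V : lmodType S)
    (mul : V -> V -> V) : Prop :=
  [/\ bilinear_mul mul, associative mul &
      exists e, left_id e mul /\ right_id e mul].

Definition generated_by (S : comNzRingType) (V : lmodType S)
    (mul : V -> V -> V) (I : Type) (d : I -> V) : Prop :=
  forall P : V -> Prop,
    P 0 -> (forall (c : S) u v, P u -> P v -> P (c *: u + v)) ->
    (forall u v, P u -> P v -> P (mul u v)) ->
    (forall i, P (d i)) -> forall v, P v.

Definition specialize (F : comNzRingType) (n : nat)
    (mul : 'rV[{poly F}]_n -> 'rV[{poly F}]_n -> 'rV[{poly F}]_n)
    (s : F) (u v : 'rV[F]_n) : 'rV[F]_n :=
  map_mx (horner^~ s) (mul (map_mx polyC u) (map_mx polyC v)).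

Definition formal_deformation (F : comNzRingType) (n : nat)
    (mul0 : 'rV[F]_n -> 'rV[F]_n -> 'rV[F]_n)
    (mul : 'rV[{poly F}]_n -> 'rV[{poly F}]_n -> 'rV[{poly F}]_n) : Prop :=
  [/\ bilinear_mul mul, associative mul &
      forall u v, specialize mul 0 u v = mul0 u v].

(* Isomorphism of (V, mul) with the F-algebra given by the ring Q and the      *)
(* structure map eta : F -> Q.  A bijective multiplicative map automatically   *)
(* sends the unit of (V, mul) to 1.                                            *)
Definition algebra_iso (F : comNzRingType) (V : lmodType F)
    (mul : V -> V -> V) (Q : pzRingType) (eta : F -> Q) : Prop :=
  exists phi : V -> Q,
    [/\ bijective phi,
        forall u v, phi (u + v) = phi u + phi v,
        forall c v, phi (c *: v) = eta c * phi v &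
        forall u v, phi (mul u v) = phi u * phi v].

(* Main.v *)
Require Import Defs.
From mathcomp Require Import all_boot all_algebra all_field.
From mathcomp Require Import boolp reals complex monalg.

Set Implicit Arguments.
Unset Strict Implicit.
Unset Printing Implicit Defensive.

Import GRing.Theory.
Local Open Scope ring_scope.

(** The multiplication [star_t] is nothing but the multiplication of the image
    B of f, written in the coordinates given by the f(q_i).

    B is a C[t]-subalgebra of A[t], and it is spanned over C[t] by the n
    elements f(q_i), because these span the images of the monomials.  Since
    every element of A becomes an element of B after multiplication by a power
    of t, the rank of B is n.  So n generators of a module of rank n are given,
    and a determinant argument ([spanning_comb_inj]) shows that they are
    linearly independent.  Hence u |-> sum_i u_i f(q_i) is a bijection from
    C[t]^n onto B, which carries the multiplication with structure constants
    zeta + t xi to that of A[t] ([f_comb_star]); associativity and the unit of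
    [star_t] come from A[t] ([star_algebra]).

    Evaluation at t = s is a surjection C[t]^n -> C^n compatible with [star_t]
    and its specialization, so each specialization is again an associative
    unital algebra ([specialize_algebra]).  This algebra is the fibre
    B / (t - s)B.  On the other hand f identifies C[x,y][t] / I with B, thus
    C[x,y][t] / <I, t - s> with the same fibre.  The isomorphism of
    [fibre_iso] sends v to the class of sum_i v_i q_i; its injectivity rests
    on the fact that f maps <I, t - s> into (t - s)B ([f_ideal_gen]).  The
    theorem uses s = 0 for the deformed algebra and s = 1 for the quotient. *)

(** * Polynomials with scalar coefficients *)

Section StructureMaps.
Variables (F : comNzRingType) (L : lalgType F).

Lemma poly_tD : {morph poly_t L : c e / c + e}.
Proof. exact: (raddfD (map_poly (in_alg L))). Qed.

Lemma poly_tM : {morph poly_t L : c e / c * e}.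
Proof. exact: (rmorphM (map_poly (in_alg L))). Qed.

Lemma poly_tC c : poly_t L c%:P = scal_t L c.
Proof. exact: map_polyC. Qed.

Lemma poly_tX : poly_t L 'X = 'X.
Proof. exact: map_polyX. Qed.

Lemma poly_tXB c : poly_t L ('X - c%:P) = 'X - scal_t L c.
Proof. by rewrite poly_tD poly_tX -polyCN poly_tC /scal_t scaleNr polyCN. Qed.

End StructureMaps.

Lemma poly_t_comm (F : comNzRingType) (L : algType F) (c : {poly F})
  (p : {poly L}) : poly_t L c * p = p * poly_t L c.
Proof.
apply/polyP => j; rewrite coefM coefMr; apply: eq_bigr => k _.
by rewrite coef_map /= -scalerAl mul1r -scalerAr mulr1.
Qed.

(** * Combinations with coefficients in F[t] *)

Section Combination.
Variables (F : comNzRingType) (L : lalgType F) (n : nat).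
Implicit Types (u v : 'rV[{poly F}]_n) (q : 'I_n -> {poly L}).

Definition comb q u : {poly L} := \sum_(i < n) poly_t L (u 0 i) * q i.

Lemma combD q : {morph comb q : u v / u + v}.
Proof.
move=> u v; rewrite /comb -big_split; apply: eq_bigr => i _.
by rewrite mxE poly_tD mulrDl.
Qed.

Lemma combZ q c u : comb q (c *: u) = poly_t L c * comb q u.
Proof.
by rewrite /comb mulr_sumr; apply: eq_bigr => i _; rewrite mxE poly_tM mulrA.
Qed.

Lemma comb0 q : comb q 0 = 0.
Proof. by rewrite -(scale0r 0) combZ /poly_t rmorph0 mul0r. Qed.

Lemma combB q : {morph comb q : u v / u - v}.
Proof.
by move=> u v; rewrite -scaleN1r combD combZ /poly_t rmorphN1 mulN1r.
Qed.

Lemma comb_sum q (I : finType) (u : I -> 'rV_n) :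
  comb q (\sum_i u i) = \sum_i comb q (u i).
Proof. exact: (big_morph (comb q) (combD q) (comb0 q)). Qed.

End Combination.

(** * Multiplications given by structure constants, and their specializations *)

Lemma bilinear_extP (S : comNzRingType) (n : nat)
    (g : 'I_n -> 'I_n -> 'rV[S]_n) :
  bilinear_mul (bilinear_ext g).
Proof.
rewrite /bilinear_ext; split=> [u c v w|v c u w].
  rewrite scaler_sumr -big_split; apply: eq_bigr => k _ /=.
  rewrite scaler_sumr -big_split; apply: eq_bigr => l _ /=.
  by rewrite !mxE scalerA -scalerDl mulrDr mulrCA.
rewrite scaler_sumr -big_split; apply: eq_bigr => k _ /=.
rewrite scaler_sumr -big_split; apply: eq_bigr => l _ /=.
by rewrite !mxE scalerA -scalerDl mulrDl mulrA.
Qed.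

Section Bilinear.
Variables (F : comNzRingType) (n : nat).
Variables (g : 'I_n -> 'I_n -> 'rV[{poly F}]_n) (s : F).

Lemma eval_mxD : {morph @map_mx _ _ (horner^~ s) 1 n : u v / u + v}.
Proof. by move=> u v; apply/rowP => i; rewrite !mxE hornerD. Qed.

Lemma eval_bilinear_ext u v :
  map_mx (horner^~ s) (bilinear_ext g u v) =
  bilinear_ext (fun k l => map_mx (horner^~ s) (g k l))
    (map_mx (horner^~ s) u) (map_mx (horner^~ s) v).
Proof.
have ev0 : map_mx (horner^~ s) (0 : 'rV_n) = 0.
  by apply/rowP => i; rewrite !mxE horner0.
rewrite /bilinear_ext (big_morph _ eval_mxD ev0); apply: eq_bigr => k _.
rewrite (big_morph _ eval_mxD ev0); apply: eq_bigr => l _.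
by apply/rowP => i; rewrite !mxE !hornerM.
Qed.

Lemma eval_polyC (u : 'rV[F]_n) : map_mx (horner^~ s) (map_mx polyC u) = u.
Proof. by apply/rowP => i; rewrite !mxE hornerC. Qed.

Lemma specialize_bilinear_ext :
  specialize (bilinear_ext g) s =2
  bilinear_ext (fun k l => map_mx (horner^~ s) (g k l)).
Proof.
by move=> u v; rewrite /specialize eval_bilinear_ext !eval_polyC.
Qed.

(** Evaluation at s is multiplicative and has [map_mx polyC] as a section, so
    identities and the unit descend along it. *)
Lemma specialize_algebra :
  algebra_mul (bilinear_ext g) -> algebra_mul (specialize (bilinear_ext g) s).
Proof.
move=> [_ mulA [e [mul1 mulr1]]].
have -> : specialize (bilinear_ext g) s =
    bilinear_ext (fun k l => map_mx (horner^~ s) (g k l)).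
  by apply/funext => u; apply/funext => v; rewrite specialize_bilinear_ext.
split; first exact: bilinear_extP.
  move=> u v w; rewrite -[u]eval_polyC -[v]eval_polyC -[w]eval_polyC.
  by rewrite -!eval_bilinear_ext mulA.
exists (map_mx (horner^~ s) e); split=> u; rewrite -[u]eval_polyC.
  by rewrite -eval_bilinear_ext mul1.
by rewrite -eval_bilinear_ext mulr1.
Qed.

(** The factor theorem in each entry: a vector and its value at s agree modulo
    t - s, so F^n is the quotient of F[t]^n by (t - s). *)
Lemma eval_sub_divides (u : 'rV[{poly F}]_n) :
  exists z, u - map_mx polyC (map_mx (horner^~ s) u) = ('X - s%:P) *: z.
Proof.
have /choice[z zP] : forall i : 'I_n, exists p : {poly F},
    u 0 i - (u 0 i).[s]%:P = p * ('X - s%:P).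
  by move=> i; apply/factor_theorem; rewrite /root !hornerE subrr.
exists (\row_i z i); apply/rowP => i.
by rewrite !mxE zP mulrC.
Qed.

End Bilinear.

(** * Independence of n generators of a module of rank n *)

Section Coordinates.
Variables (F : fieldType) (A : falgType F).
Let N := \dim {: A}.

(** The F[t]-linear map A[t] -> F[t]^N that reads off coordinates in the
    basis [vbasis {: A}] of A[t]. *)
Definition coord_row (p : {poly A}) : 'rV[{poly F}]_N :=
  \row_k map_poly (coord (vbasis {: A}) k) p.

Lemma coord_row_sum (I : finType) (p : I -> {poly A}) :
  coord_row (\sum_i p i) = \sum_i coord_row (p i).
Proof.
apply/rowP => k; rewrite summxE mxE raddf_sum.
by apply: eq_bigr => i _; rewrite mxE.
Qed.

Lemma coord_rowZ c p : coord_row (poly_t A c * p) = c *: coord_row p.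
Proof.
apply/rowP => k; rewrite !mxE; apply/polyP => j.
rewrite coef_map coefM raddf_sum coefM; apply: eq_bigr => l _ /=.
by rewrite !coef_map /= -scalerAl mul1r linearZ.
Qed.

Lemma coord_row_comb n (q : 'I_n -> {poly A}) u :
  coord_row (comb q u) = u *m \matrix_i coord_row (q i).
Proof.
rewrite coord_row_sum mulmx_sum_row; apply: eq_bigr => i _.
by rewrite coord_rowZ rowK.
Qed.

Lemma coord_row_basis (j : 'I_N) e :
  coord_row (((vbasis {: A})`_j)%:P * 'X^e) = 'X^e *: delta_mx 0 j.
Proof.
apply/rowP => k; rewrite !mxE /=; apply/polyP => d.
rewrite coef_map coefCM coefXn mulr_natr raddfMn /=.
have /basis_free freeX := vbasisP {: A}.
rewrite coord_free // mulr_natr coefMn coefXn -mulrnA mulnC mulrnA.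
by rewrite (eq_sym k).
Qed.

(** Let M be the coordinate matrix of the q_i, and C the matrix that expresses
    the t^(e j) b_j through the q_i, where the b_j are the basis of A.  Then
    C M = diag(t^(e j)) has nonzero determinant, hence so has M, and F[t] is a
    domain. *)
Lemma spanning_comb_inj (q : 'I_N -> {poly A}) (e : 'I_N -> nat) :
    (forall j : 'I_N,
      exists u, ((vbasis {: A})`_j)%:P * 'X^(e j) = comb q u) ->
  injective (comb q).
Proof.
move=> /choice[C CE].
pose M := \matrix_i coord_row (q i).
have CM : (\matrix_j C j) *m M = diag_mx (\row_j 'X^(e j)).
  apply/row_matrixP => j.
  rewrite row_mul rowK -coord_row_comb -CE coord_row_basis.
  by apply/rowP => k; rewrite !mxE eqxx /= mulr_natr eq_sym.
have detM : \det M != 0.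
  have : \det (\matrix_j C j) * \det M != 0.
    rewrite -det_mulmx CM det_diag; apply/prodf_neq0 => j _.
    by rewrite mxE expf_neq0 ?polyX_eq0.
  by rewrite mulf_eq0 negb_or => /andP[].
move=> u v /(congr1 coord_row); rewrite !coord_row_comb => uMvM.
have := congr1 (mulmx^~ (\adj M)) uMvM.
rewrite -!mulmxA mul_mx_adj !mul_mx_scalar => /rowP uv; apply/rowP => i.
by have := uv i; rewrite !mxE; apply: mulfI.
Qed.

End Coordinates.

(** * The image of the presentation and its fibres *)

Section Presentation.
Variables (F : fieldType) (A : falgType F) (L : lalgType F).
Variable f : {rmorphism {poly L} -> {poly A}}.
Hypothesis f_scal : forall c, f (scal_t L c) = scal_t A c.
Hypothesis f_t : f 'X = 'X.

Lemma f_poly_t c : f (poly_t L c) = poly_t A c.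
Proof.
elim/poly_ind: c => [|c d IHc]; first by rewrite /poly_t !rmorph0.
by rewrite !(poly_tD, poly_tM) !poly_tC !poly_tX rmorphD rmorphM IHc f_t f_scal.
Qed.

Lemma f_comb n (q : 'I_n -> {poly L}) u :
  f (comb q u) = comb (fun i => f (q i)) u.
Proof.
by rewrite rmorph_sum; apply: eq_bigr => i _; rewrite rmorphM f_poly_t.
Qed.

Variables (n : nat) (q : 'I_n -> {poly L}).
Variable g : 'I_n -> 'I_n -> 'rV[{poly F}]_n.
Hypothesis f_rel : forall k l, f (q k * q l) = f (comb q (g k l)).

(** This is where centrality of F[t] in A[t] enters: the coefficients of v have
    to be moved across the q_k. *)
Lemma f_comb_star u v :
  f (comb q (bilinear_ext g u v)) = f (comb q u) * f (comb q v).
Proof.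
rewrite -rmorphM mulr_suml !comb_sum !rmorph_sum; apply: eq_bigr => k _.
rewrite comb_sum mulr_sumr !rmorph_sum; apply: eq_bigr => l _.
rewrite combZ !rmorphM !f_poly_t -f_rel rmorphM poly_tM.
by rewrite -!mulrA; congr (_ * _); rewrite !mulrA poly_t_comm.
Qed.

(* Together with surjectivity below: the f(q_i) form an F[t]-basis of the
   image of f. *)
Hypothesis comb_injf : injective (fun u => f (comb q u)).
Hypothesis comb_surj : forall p, exists u, f p = f (comb q u).

Lemma star_algebra : algebra_mul (bilinear_ext g).
Proof.
split; first exact: bilinear_extP.
  by move=> u v w; apply: comb_injf; rewrite !f_comb_star mulrA.
have [e eE] := comb_surj 1; exists e.
by split=> u; apply: comb_injf; rewrite f_comb_star -eE rmorph1 ?mul1r ?mulr1.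
Qed.

Definition fibre_rel (s : F) (p : {poly L}) := f p = 0 \/ p = 'X - scal_t L s.

(** f sends the kernel of f to 0 and t - s to t - s, which is central, so the
    two-sided ideal lands in the multiples of t - s.  The cofactor has to lie in
    the image of f, not merely in A[t]: t - s may divide an element of the
    image within A[t] only. *)
Lemma f_ideal_gen s p : ideal_gen (fibre_rel s) p ->
  exists z, f p = ('X - scal_t A s) * f z.
Proof.
elim=> {p} [p [fp0|->]||p p' _ [z pz] _ [z' pz']|c p _ [z pz]|c p _ [z pz]].
- by exists 0; rewrite fp0 rmorph0 mulr0.
- by exists 1; rewrite rmorph1 mulr1 rmorphB f_t f_scal.
- by exists 0; rewrite !rmorph0 mulr0.
- by exists (z - z'); rewrite !rmorphB pz pz' mulrBr.
- exists (c * z); rewrite !rmorphM pz -poly_tXB.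
  by rewrite mulrA -poly_t_comm mulrA.
by exists (z * c); rewrite !rmorphM pz mulrA.
Qed.

(** The fibre at t = s of the image of f, computed in two ways: as the
    specialized multiplication on F^n, and as the quotient by <ker f, t - s>. *)
Lemma fibre_iso s : algebra_iso (specialize (bilinear_ext g) s)
  (fun c => quot_proj (fibre_rel s) (scal_t L c)).
Proof.
pose proj := quot_proj (fibre_rel s).
pose ev := @map_mx _ _ (horner^~ s) 1 n.
pose phi (v : 'rV[F]_n) := proj (comb q (map_mx polyC v)).
(* [proj] factors through f because the ideal contains its kernel. *)
have proj_f p p' : f p = f p' -> proj p = proj p'.
  move=> fpp'; apply/quot_projP; apply: ideal_gen_base; left.
  by rewrite rmorphB fpp' subrr.
(* In the quotient t = s, so the coefficients may be evaluated at s. *)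
have phi_ev u : phi (ev u) = proj (comb q u).
  have [z zE] := eval_sub_divides s u.
  apply/esym/quot_projP; rewrite -combB zE combZ; apply: ideal_gen_Mr.
  by apply: ideal_gen_base; right; rewrite poly_tXB.
have phiB u v : phi (u - v) = phi u - phi v.
  by rewrite /phi map_mxB combB /proj rmorphB.
have phi_inj : injective phi.
  move=> u v /eqP; rewrite -subr_eq0 -phiB => /eqP phi0.
  apply/eqP; rewrite -subr_eq0; apply/eqP.
  have /quot_projP/f_ideal_gen[z] : phi (u - v) = proj 0.
    by rewrite phi0 /proj rmorph0.
  have [w ->] := comb_surj z.
  rewrite subr0 -poly_tXB -f_poly_t -rmorphM -combZ => /comb_injf uvE.
  (* A constant vector divisible by t - s vanishes: evaluate at s. *)
  rewrite -[LHS](eval_polyC s) uvE; apply/rowP => i.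
  by rewrite !mxE hornerM !hornerE subrr mul0r.
have phi_surj y : exists v, phi v = y.
  have [u uE] := comb_surj (repr y).
  by exists (ev u); rewrite phi_ev -(proj_f _ _ uE) /proj quot_proj_repr.
exists phi; split.
- have [psi psiK] := choice phi_surj.
  by exists psi => // v; apply: phi_inj; rewrite psiK.
- by move=> u v; rewrite /phi map_mxD combD /proj rmorphD.
- by move=> c v; rewrite /phi map_mxZ combZ poly_tC /proj rmorphM.
move=> u v; rewrite phi_ev -rmorphM; apply: proj_f.
by rewrite f_comb_star rmorphM.
Qed.

End Presentation.

(** * The free algebra *)

(** As an F[t]-module, F<x,y>[t] is spanned by the monomials in x and y. *)
Lemma poly_ncpoly_ind (F : comNzRingType) (P : {poly ncpoly F} -> Prop) :
    P 0 -> (forall p p', P p -> P p' -> P (p + p')) ->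
    (forall c p, P p -> P (poly_t _ c * p)) ->
    (forall w, P (ncmon F w)%:P) ->
  forall p, P p.
Proof.
move=> P0 PD PZ PM; elim/poly_ind=> [//|p c Pp]; apply: (PD).
  by rewrite commr_polyX -poly_tX; apply: (PZ).
rewrite [c]monalgE rmorph_sum; apply: (big_ind P P0 PD) => w _.
have := PZ (c@_w)%:P _ (PM w); congr P.
rewrite poly_tC -polyCM -scalerAl mul1r; congr polyC.
by apply/malgP => v; rewrite mcoeffZ !mcoeffU mulrnAr mulr1.
Qed.

Theorem theorem3p11 (R : realType) (A : falgType R[i]) (n : nat)
  (hn : \dim {: A} = n)
  (m : nat) (hm : (0 < m)%N) (a b : 'I_m -> A)
  (hgen : agenv <<[:: (\sum_(i < m) a i)%R; (\sum_(i < m) b i)%R]>>%VS = {: A}%VS)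
  (f : {rmorphism {poly ncpoly R[i]} -> {poly A}})
  (f_scal : forall c : R[i], f (scal_t (ncpoly R[i]) c) = scal_t A c)
  (f_x : f (ncx R[i])%:P = \sum_(i < m) (a i)%:P * 'X^(i.+1))
  (f_y : f (ncy R[i])%:P = \sum_(i < m) (b i)%:P * 'X^(i.+1))
  (f_t : f 'X = 'X)
  (hstanding : forall r : A, exists (i : nat) (p : {poly ncpoly R[i]}),
     f p = r%:P * 'X^i)
  (q : 'I_n -> {poly ncpoly R[i]})
  (hq : forall w : {fmonom bool}, exists c : 'I_n -> {poly R[i]},
     f (ncmon R[i] w)%:P = \sum_(i < n) poly_t A (c i) * f (q i))
  (zeta : 'I_n -> 'I_n -> 'I_n -> R[i])
  (xi : 'I_n -> 'I_n -> 'I_n -> {poly R[i]})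
  (hrel : forall k l : 'I_n,
     f (q k * q l
        - \sum_(i < n) (scal_t (ncpoly R[i]) (zeta i k l) * q i
                        + 'X * poly_t (ncpoly R[i]) (xi i k l) * q i)) = 0) :
  let d0 := fun k l : 'I_n => \sum_(i < n) zeta i k l *: basis_vec R[i] i in
  let dt := fun k l : 'I_n =>
    \sum_(i < n) ((zeta i k l)%:P *: basis_vec {poly R[i]} i
                  + ('X * xi i k l) *: basis_vec {poly R[i]} i) in
  let star_0 := bilinear_ext d0 in
  let star_t := bilinear_ext dt in
  let star_1 := specialize star_t 1 in
  [/\ algebra_mul star_0,
      formal_deformation star_0 star_t,
      algebra_mul star_1,
      generated_by star_1 (@basis_vec R[i] n) &
      algebra_iso star_1
        (fun c => quot_proj (fun p => f p = 0 \/ p = 'X - 1)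
                    (scal_t (ncpoly R[i]) c))].
Proof.
move=> d0 dt star_0 star_t star_1; subst n.
have fE := f_comb f_scal f_t.
pose g k l := \row_i ((zeta i k l)%:P + 'X * xi i k l).
have dtE k l : dt k l = g k l.
  rewrite (row_sum_delta (g k l)); apply: eq_bigr => i _.
  by rewrite mxE scalerDl.
have ev0 k l : map_mx (horner^~ 0) (dt k l) = d0 k l.
  rewrite dtE [LHS]row_sum_delta; apply: eq_bigr => i _.
  by rewrite !mxE !hornerE.
have f_rel k l : f (q k * q l) = f (comb q (dt k l)).
  apply/eqP; rewrite -subr_eq0 -rmorphB -[X in _ == X](hrel k l); apply/eqP.
  congr (f (_ - _)); apply: eq_bigr => i _.
  by rewrite dtE mxE poly_tD poly_tM poly_tC poly_tX mulrDl.
have comb_surj p : exists u, f p = f (comb q u).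
  elim/poly_ncpoly_ind: p => [|p p' [u uE] [v vE]|c p [u uE]|w].
  - by exists 0; rewrite comb0.
  - by exists (u + v); rewrite combD !rmorphD uE vE.
  - by exists (c *: u); rewrite combZ !rmorphM uE.
  have [c cE] := hq w; exists (\row_i c i).
  by rewrite fE cE; apply: eq_bigr => i _; rewrite mxE.
have comb_injf : injective (fun u => f (comb q u)).
  have [e eP] := choice (fun j : 'I_(\dim {: A}) => hstanding (vbasis {: A})`_j).
  have inj_fq : injective (comb (fun i => f (q i))).
    apply: (@spanning_comb_inj _ _ _ e) => j.
    have [p pE] := eP j; have [w wE] := comb_surj p.
    by exists w; rewrite -pE wE fE.
  move=> u v fuv; apply: inj_fq.
  exact: etrans (esym (fE _ q u)) (etrans fuv (fE _ q v)).
have star_t_alg : algebra_mul star_t :=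
  star_algebra f_scal f_t f_rel comb_injf comb_surj.
have star_0E u v : specialize star_t 0 u v = star_0 u v.
  rewrite specialize_bilinear_ext; apply: eq_bigr => k _; apply: eq_bigr => l _.
  by rewrite ev0.
split.
- have <- : specialize star_t 0 = star_0.
    by apply/funext => u; apply/funext => v.
  exact: specialize_algebra.
- by have [bil mulA _] := star_t_alg; split.
- exact: specialize_algebra.
(* The d_i already span the underlying vector space. *)
- move=> P P0 PZ _ Pd v; rewrite [v]row_sum_delta.
  apply: (big_ind P) => // [u w Pu Pw|i _].
    by rewrite -[u]scale1r; apply: PZ.
  by rewrite -[_ *: _]addr0; apply: PZ P0; apply: Pd.
have := fibre_iso f_scal f_t f_rel comb_injf comb_surj 1.
have -> // : fibre_rel f 1 = (fun p => f p = 0 \/ p = 'X - 1).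
by apply/funext => p; rewrite /fibre_rel /scal_t scale1r.
Qed.
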